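(* Let $G$ be a functional digraph, written as a disjoint union $$G=\Big(\bigsqcup_{i=1}^{s^{\circ}}T_i^{\circ}\Big)\sqcup\Big(\bigsqcup_{i=1}^{s^{\circlearrowleft}}T_i^{\circlearrowleft}\Big)$$ of vertex-rooted trees $T_i^{\circ}$ and cycle-rooted trees $T_i^{\circlearrowleft}$. Then its successor-closed counting polynomial is $$A_G(x)=\Big(\prod_{i=1}^{s^{\circ}}R_{T_i^{\circ}}(x)\Big)\cdot\Big(\prod_{i=1}^{s^{\circlearrowleft}}R_{T_i^{\circlearrowleft}}(x)\Big),$$ where the polynomials $R$ are defined as follows. For a vertex-rooted tree $T^{\circ}$ and a vertex $u$ of it, let $T_u^{\circ}$ be the subtree rooted at $u$ and define recursively $$R_{T_u^{\circ}}(x):=\begin{cases}1+x,&\text{if }u\text{ is a leaf},\\ 1+x\prod_{v}R_{T_v^{\circ}}(x),&\text{otherwise},\end{cases}$$ the product ranging over the children $v$ of $u$ (the vertices $v$ with an edge $v\to u$); $R_{T^{\circ}}:=R_{T_r^{\circ}}$ with $r$ the root of $T^{\circ}$. For a cycle-rooted tree $T^{\circlearrowleft}$ with cycle vertices $u_1,\dots,u_\ell$, $$R_{T^{\circlearrowleft}}(x):=1+\prod_{i=1}^{\ell}\big(R_{T_{u_i}^{\circ}}(x)-1\big),$$ where $T_{u_i}^{\circ}$ is the vertex-rooted tree hanging at $u_i$, with root $u_i$ and excluding the other vertices of the cycle.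
   Context: All digraphs are finite directed graphs $G=(V,E)$ without self-loops. $G(u)$ denotes the set of vertices $v$ with an edge $u\to v$. A digraph is functional if every vertex has out-degree at most one. A vertex-rooted tree is a tree with a distinguished root, all edges directed from the leaves towards the root (each non-root vertex has exactly one outgoing edge, to its parent; the root has none); a leaf is a vertex with no incoming edge. A cycle-rooted tree is a directed cycle $u_1\to u_2\to\cdots\to u_\ell\to u_1$ in which each cycle vertex $u_i$ is the root of its own vertex-rooted tree (these trees being pairwise disjoint, possibly a single vertex). Every functional digraph is a disjoint union of vertex-rooted trees and cycle-rooted trees. A set $Q\subseteq V$ is successor-closed if $G(u)\subseteq Q$ for every $u\in Q$. The successor-closed counting polynomial is $A_G(x):=\sum_Q x^{|Q|}$, the sum ranging over all successor-closed $Q\subseteq V$. *)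

(* Defs.v *)
From mathcomp Require Import all_boot all_order all_algebra.
Set Implicit Arguments.
Unset Strict Implicit.
Unset Printing Implicit Defensive.
Import GRing.Theory.
Local Open Scope ring_scope.

Section Digraph.

Variables (V : finType) (G : rel V).

Definition functional : Prop := forall u, (#|[set v | G u v]| <= 1)%N.

Definition successor_closed (Q : {set V}) : bool :=
  [forall u in Q, [set v | G u v] \subset Q].

Definition counting_poly : {poly int} :=
  \sum_(Q : {set V} | successor_closed Q) 'X^#|Q|.

(* A vertex set stands for the subgraph of G that it induces. *)
Definition induced (T : {set V}) : rel V :=
  [rel u v | [&& u \in T, v \in T & G u v]].

Record disjoint_union (I : finType) (T : I -> {set V}) : Prop := {
  du_cover : \bigcup_i T i = [set: V];
  du_disjoint : forall i j, i != j -> [disjoint T i & T j];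
  du_edges : forall u v, G u v -> exists i, induced (T i) u v
}.

Record vertex_rooted_tree (T : {set V}) (r : V) : Prop := {
  vrt_root : r \in T;
  vrt_root_out : [set v | induced T r v] = set0;
  vrt_out : forall u, u \in T -> u != r -> #|[set v | induced T u v]| = 1%N;
  vrt_connect : forall u, u \in T -> connect (induced T) u r
}.

(* c lists the cycle vertices in cyclic order; H u is the vertex set of the  *)
(* tree hanging at the cycle vertex u (H is irrelevant outside c).           *)
Record cycle_rooted_tree (T : {set V}) (c : seq V) (H : V -> {set V}) : Prop := {
  crt_nonempty : c != [::];
  crt_uniq : uniq c;
  crt_cycle : cycle G c;
  crt_trees : forall u, u \in c -> vertex_rooted_tree (H u) u;
  crt_disjoint : forall u v, u \in c -> v \in c -> u != v ->
    [disjoint H u & H v];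
  crt_cover : \bigcup_(u in c) H u = T;
  crt_edges : forall u v, induced T u v ->
    (u \in c /\ v = next c u) \/ (exists2 w, w \in c & induced (H w) u v)
}.

Definition leaf (T : {set V}) (u : V) : bool := [set v | induced T v u] == set0.

(* The recursion on subtrees, with a recursion depth n; depth #|T| is enough *)
(* on a vertex-rooted tree, which is what tree_polyE states.                 *)
Fixpoint tree_poly_rec (T : {set V}) (n : nat) (u : V) : {poly int} :=
  if n is n'.+1 then
    if leaf T u then 1 + 'X
    else 1 + 'X * \prod_(v | induced T v u) tree_poly_rec T n' v
  else 0.

(* tree_poly T u is the polynomial R of the subtree of T rooted at u. *)
Definition tree_poly (T : {set V}) (u : V) : {poly int} :=
  tree_poly_rec T #|T| u.

Definition cycle_tree_poly (c : seq V) (H : V -> {set V}) : {poly int} :=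
  1 + \prod_(u <- c) (tree_poly (H u) u - 1).

Section TreePoly.

Variables (T : {set V}) (r : V).
Hypothesis Tr : vertex_rooted_tree T r.

Let below u := [set v in T | connect (induced T) v u].

Lemma root_induced v : induced T r v = false.
Proof.
apply/negP => rv; have : v \in [set v | induced T r v] by rewrite in_set.
by rewrite (vrt_root_out Tr) in_set0.
Qed.

Lemma induced_inj u v w : induced T u v -> induced T u w -> v = w.
Proof.
move=> uv uw; have uT : u \in T by case/andP: uv.
have [ur|ur] := eqVneq u r; first by rewrite ur root_induced in uv.
have /eqP/cards1P[z zE] := vrt_out Tr uT ur.
have : v \in [set v | induced T u v] by rewrite in_set.
have : w \in [set v | induced T u v] by rewrite in_set.
by rewrite zE !in_set1 => /eqP -> /eqP ->.
Qed.

Lemma induced_acyclic u v : induced T v u -> ~~ connect (induced T) u v.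
Proof.
move=> vu; apply/negP => uv.
have step w w' : connect (induced T) w v -> induced T w w' ->
    connect (induced T) w' v.
  case/connectP => -[|z p] /= pp vE ww'.
    by rewrite vE in vu uv *; rewrite (induced_inj ww' vu).
  case/andP: pp => wz pp.
  by rewrite (induced_inj ww' wz); apply/connectP; exists p.
have stepp p : forall w, connect (induced T) w v -> path (induced T) w p ->
    connect (induced T) (last w p) v.
  elim: p => //= z p IHp w wv /andP[wz pp].
  by apply: IHp pp; apply: step wv wz.
have uT : u \in T by case/and3P: vu.
have /connectP[p pp rE] := vrt_connect Tr uT.
have := stepp _ _ uv pp; rewrite -rE => /connectP[[|z q] /=].
  by move=> _ vr; rewrite vr root_induced in vu.
by case/andP => rz; rewrite root_induced in rz.
Qed.

Lemma card_below u v : induced T v u -> (#|below v| < #|below u|)%N.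
Proof.
move=> vu; apply/proper_card/properP; split.
  apply/subsetP => w; rewrite !inE => /andP[-> wv] /=.
  exact: connect_trans wv (connect1 vu).
exists u; first by rewrite inE connect0 andbT; case/and3P: vu.
by rewrite inE negb_and induced_acyclic // orbT.
Qed.

Lemma tree_poly_rec_stable n m u : u \in T ->
  (#|below u| <= n)%N -> (#|below u| <= m)%N ->
  tree_poly_rec T n u = tree_poly_rec T m u.
Proof.
elim: n m u => [|n IHn] [|m] u uT //.
- rewrite leqn0 cards_eq0 => /eqP/setP/(_ u).
  by rewrite !inE uT connect0.
- move=> _; rewrite leqn0 cards_eq0 => /eqP/setP/(_ u).
  by rewrite !inE uT connect0.
move=> un um /=; case: ifP => // _; congr (1 + _ * _).
apply: eq_bigr => v vu; apply: IHn; first by case/and3P: vu.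
  exact: leq_trans (card_below vu) un.
exact: leq_trans (card_below vu) um.
Qed.

Lemma tree_polyE u : u \in T ->
  tree_poly T u =
    if leaf T u then 1 + 'X
    else 1 + 'X * \prod_(v | induced T v u) tree_poly T v.
Proof.
move=> uT; have bT w : (#|below w| <= #|T|)%N.
  by apply/subset_leq_card/subsetP => z; rewrite inE => /andP[].
rewrite {1}/tree_poly (@tree_poly_rec_stable _ #|T|.+1) ?(leq_trans (bT u)) //.
Qed.

End TreePoly.

End Digraph.

(* Main.v *)
(** A successor-closed set of a disjoint union is a union of successor-closed
    sets of the parts, so the counting polynomial is multiplicative. In a rooted
    tree every vertex reaches the root, so a nonempty successor-closed set
    contains the root, and what remains is an arbitrary choice of
    successor-closed sets in the subtrees of the children: this is the recursion
    defining [R]. In a cycle-rooted tree a nonempty successor-closed set contains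
    the whole cycle, hence meets each hanging tree in a nonempty
    successor-closed set, and these can be chosen independently. *)

Require Import Defs.
From mathcomp Require Import all_boot all_order all_algebra.
Local Open Scope ring_scope.
Import GRing.Theory.

Set Implicit Arguments.
Unset Strict Implicit.
Unset Printing Implicit Defensive.

(** * Multiplicativity of size-generating functions over disjoint sets *)

(** Expanding the product picks one subset of each [T i]. By disjointness, the union of these
    subsets determines them as its traces on the [T i], and cardinalities add up. *)
Lemma prod_sum_subsets (V I : finType) (D : {pred I}) (T : I -> {set V})
    (P : I -> {pred {set V}}) :
  {in D &, forall i j, i != j -> [disjoint T i & T j]} ->
  \prod_(i in D) \sum_(Q : {set V} | (Q \subset T i) && P i Q)
    'X^#|Q| =
  \sum_(Q : {set V} | (Q \subset \bigcup_(i in D) T i)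
      && [forall i in D, P i (Q :&: T i)]) 'X^#|Q| :> {poly int}.
Proof.
move=> disjT; rewrite (big_distr_big_dep set0) /=.
pose join (f : {ffun I -> {set V}}) := \bigcup_i f i.
pose cut (Q : {set V}) := [ffun i => if i \in D then Q :&: T i else set0].
(* The value [set0] outside [D] is the default passed to [big_distr_big_dep]; with it, indices
   outside [D] add nothing to [join f]. *)
pose tame (f : {ffun I -> {set V}}) :=
  forall i, if i \in D then f i \subset T i else f i == set0.
have tame_in f i x : tame f -> x \in f i -> i \in D /\ x \in T i.
  move=> /(_ i) + xi; case: ifP => [_ fT|_ /eqP f0].
    by split=> //; apply: subsetP xi.
  by rewrite f0 inE in xi.
have tame_disj f i j : tame f -> i != j -> [disjoint f i & f j].
  move=> ft ij; apply/pred0P => x /=; apply/negP => /andP[xi xj].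
  have [Di xTi] := tame_in _ _ _ ft xi; have [Dj xTj] := tame_in _ _ _ ft xj.
  by have /pred0P/(_ x) := disjT _ _ Di Dj ij; rewrite /= xTi xTj.
have cutK f i : tame f -> i \in D -> join f :&: T i = f i.
  move=> ft Di; apply/setP => x; rewrite inE; apply/andP/idP.
    case=> /bigcupP[j _ xj] xi; have [<- //|ij] := eqVneq j i.
    have [Dj xTj] := tame_in _ _ _ ft xj.
    by have /pred0P/(_ x) := disjT _ _ Dj Di ij; rewrite /= xi xTj.
  by move=> xi; split; [apply/bigcupP; exists i | case: (tame_in _ _ _ ft xi)].
have joinK (Q : {set V}) : Q \subset \bigcup_(i in D) T i -> join (cut Q) = Q.
  move=> sQ; apply/setP => x; apply/bigcupP/idP.
    by case=> i _; rewrite ffunE; case: ifP; rewrite inE // => _ /andP[].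
  move=> xQ; have /bigcupP[i Di xi] := subsetP sQ _ xQ.
  by exists i => //; rewrite ffunE Di inE xQ.
have familyP f : f \in pfamily set0 D
      (fun i => [pred Q : {set V} | (Q \subset T i) && P i Q]) <->
    tame f /\ {in D, forall i, P i (f i)}.
  split=> [/pfamilyP[/supportP f0 fP]|[ft fP]].
    split=> i; last by move=> /fP /andP[].
    by case: ifPn => [/fP/andP[]|/f0 ->].
  apply/pfamilyP; split=> [|i Di].
    by apply/supportP => i Di; have := ft i; rewrite (negPf Di) => /eqP.
  by rewrite inE fP // andbT; have := ft i; rewrite Di.
rewrite [RHS](reindex_onto join cut); last by move=> Q /andP[/joinK].
apply: eq_big => [f|f /familyP[ft _]]; last first.
  rewrite prodrXr -sum1_card partition_disjoint_bigcup => [|i j]; last first.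
    exact: tame_disj.
  rewrite [in LHS]big_mkcond /=; congr ('X^_); apply: eq_bigr => i _.
  rewrite sum1_card; case: ifPn => // Di.
  by have := ft i; rewrite (negPf Di) => /eqP ->; rewrite cards0.
apply/idP/idP => [/familyP[ft fP]|].
  apply/andP; split; first (apply/andP; split).
  - apply/subsetP => x /bigcupP[i _ /(tame_in _ _ _ ft)[Di xi]].
    by apply/bigcupP; exists i.
  - by apply/forall_inP => i Di; rewrite cutK // fP.
  apply/eqP/ffunP => i; rewrite ffunE; case: ifPn => Di; first exact: cutK.
  by have := ft i; rewrite (negPf Di) => /eqP.
case/andP=> /andP[sf /forall_inP fP] /eqP fE.
(* Tameness comes for free: [f] equals [cut] of its own union, and every [cut] is tame. *)
have ft : tame f.
  by move=> i; case: ifP => Di; rewrite -fE ffunE Di ?subsetIr.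
by apply: (proj2 (familyP f)); split=> // i Di; rewrite -(cutK _ _ ft Di) fP.
Qed.

(** * Closed sets relative to an induced subgraph *)

Section Closed.

Variables (V : finType) (G : rel V).

(** Only edges inside [T] count, so each tree can be treated on its own. The inclusion of [Q] in [T]
    stays a separate condition, as in [prod_sum_subsets]. *)
Definition closed_in (T Q : {set V}) : bool :=
  [forall u in Q, [set v | induced G T u v] \subset Q].

Lemma closed_inP (T Q : {set V}) :
  reflect (forall u v, u \in Q -> induced G T u v -> v \in Q) (closed_in T Q).
Proof.
apply: (iffP forall_inP) => [clQ u v uQ uv|clQ u uQ].
  by apply: (subsetP (clQ u uQ)); rewrite inE.
by apply/subsetP => v; rewrite inE; apply: clQ.
Qed.

Lemma closed_in_connect (T Q : {set V}) u v :
  closed_in T Q -> u \in Q -> connect (induced G T) u v -> v \in Q.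
Proof.
move=> /closed_inP clQ uQ /connectP[p pp ->].
by elim: p u uQ pp => //= w p IHp u uQ /andP[uw]; apply: IHp; apply: clQ uw.
Qed.

Lemma closed_in0 (T : {set V}) : closed_in T set0.
Proof. by apply/closed_inP => u v; rewrite inE. Qed.

(** The empty set contributes the constant 1 that appears in both formulas for [R]. *)
Lemma sum_closed_in (T : {set V}) :
  \sum_(Q : {set V} | (Q \subset T) && closed_in T Q) 'X^#|Q| =
  1 + \sum_(Q : {set V} | (Q \subset T) && (closed_in T Q && (Q != set0)))
        'X^#|Q| :> {poly int}.
Proof.
rewrite (bigD1 set0) ?sub0set ?closed_in0 //= cards0 expr0; congr (_ + _).
by apply: eq_bigl => Q; rewrite andbA.
Qed.

(** * Vertex-rooted trees *)

Section Tree.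

Variables (T : {set V}) (r : V).
Hypothesis Tr : vertex_rooted_tree G T r.

Definition below u := [set v in T | connect (induced G T) v u].

Lemma below_root : below r = T.
Proof.
apply/setP => v; rewrite inE; case vT: (v \in T) => //=.
exact: (vrt_connect Tr vT).
Qed.

Lemma belowxx u : u \in T -> u \in below u.
Proof. by rewrite inE connect0 andbT. Qed.

(** A vertex has at most one outgoing edge in the tree, so a nonempty path from [w] must start with
    the edge to [w']. *)
Lemma connect_step w w' v :
  connect (induced G T) w v -> induced G T w w' ->
  w = v \/ connect (induced G T) w' v.
Proof.
case/connectP => -[|z p] /= pp vE ww'; first by left.
case/andP: pp => wz pp; right.
by rewrite (induced_inj Tr ww' wz); apply/connectP; exists p.
Qed.

(** Since outgoing edges are unique, two paths from [w] follow the same route, and one is a prefix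
    of the other. *)
Lemma connect_comparable w u v :
  connect (induced G T) w u -> connect (induced G T) w v ->
  connect (induced G T) u v \/ connect (induced G T) v u.
Proof.
case/connectP => p pp ->; elim: p w pp => [|z p IHp] w /=; first by left.
case/andP => wz pp /connect_step-/(_ _ wz)[<-|]; last exact: IHp.
by right; apply: connect_trans (connect1 wz) _; apply/connectP; exists p.
Qed.

(** A nonempty path from [v] to [w] passes through the parent [u] and would close a cycle with the
    edge from [w] to [u]. *)
Lemma connect_siblings u v w : induced G T v u -> induced G T w u ->
  connect (induced G T) v w -> v = w.
Proof.
move=> vu wu /connect_step-/(_ _ vu)[//|uw].
by have := induced_acyclic Tr wu; rewrite uw.
Qed.

Lemma below_disjoint u v w : induced G T v u -> induced G T w u ->
  v != w -> [disjoint below v & below w].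
Proof.
move=> vu wu vw; apply/pred0P => x /=; apply/negP; rewrite !inE.
case/andP => /andP[_ xv] /andP[_ xw]; case/eqP: vw.
have [vw|wv] := connect_comparable xv xw.
  exact: (connect_siblings vu wu vw).
exact: (esym (connect_siblings wu vu wv)).
Qed.

Lemma below_children u : u \in T ->
  \bigcup_(v in [pred v | induced G T v u]) below v = below u :\ u.
Proof.
move=> uT; apply/setP => w; rewrite !inE; apply/bigcupP/idP.
  case=> v; rewrite !inE => vu /andP[-> wv] /=.
  rewrite (connect_trans wv (connect1 vu)) andbT.
  by apply: contraTneq wv => ->; apply: (induced_acyclic Tr vu).
(* Cut the path at its last edge: the vertex before [u] is the child whose subtree contains [w]. *)
case/and3P => wu wT /connectP[p]; case/lastP: p => [|p z] pp uE.
  by rewrite uE eqxx in wu.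
move: pp; rewrite last_rcons in uE; rewrite -{}uE rcons_path => /andP[pp vu].
by exists (last w p); rewrite !inE // wT; apply/connectP; exists p.
Qed.

(** Every vertex on a path to [u] reaches [u], so the path never leaves [below u]. *)
Lemma connect_below u w : w \in below u -> connect (induced G (below u)) w u.
Proof.
rewrite inE => /andP[wT /connectP[p]].
elim: p w wT => [|z p IHp] w wT /=; first by move=> _ ->.
case/andP=> wz pp uE; have zT : z \in T by case/and3P: wz.
apply: connect_trans (IHp _ zT pp uE); apply: connect1.
have zu : connect (induced G T) z u by apply/connectP; exists p.
have Gwz : G w z by case/and3P: wz.
rewrite /induced /= /below !in_set wT zT zu Gwz.
by rewrite (connect_trans (connect1 wz) zu).
Qed.

Lemma closed_below_root u (Q : {set V}) : Q \subset below u ->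
  closed_in (below u) Q -> Q != set0 -> u \in Q.
Proof.
move=> sQ clQ /set0Pn[w wQ].
exact: closed_in_connect clQ wQ (connect_below (subsetP sQ _ wQ)).
Qed.

Lemma sub_below u : below u \subset T.
Proof. by apply/subsetP => v; rewrite inE => /andP[]. Qed.

Lemma induced_below u v w : induced G (below u) v w -> induced G T v w.
Proof.
by case/and3P => vu wu Gvw; rewrite /induced /= Gvw !(subsetP (sub_below u)).
Qed.

(** Inside [below u], no edge leaves [u], and any other edge either ends at [u] or stays in the
    subtree of one child. Once [u] is included, closure is thus a separate condition on each child's
    subtree. *)
Lemma closed_below_setU1 u (Q : {set V}) : u \in T -> Q \subset below u :\ u ->
  closed_in (below u) (u |: Q) =
  [forall v in [pred v | induced G T v u], closed_in (below v) (Q :&: below v)].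
Proof.
move=> uT sQ; apply/closed_inP/forall_inP => [clQ v vu|clQ a b].
  apply/closed_inP => a b; rewrite inE => /andP[aQ av] /and3P[_ bv Gab].
  have belowS z : z \in below v -> z \in below u /\ z != u.
    move=> zv; have : z \in below u :\ u.
      by rewrite -(below_children uT); apply/bigcupP; exists v.
    by rewrite in_setD1 => /andP[].
  have [au _] := belowS _ av; have [bu nbu] := belowS _ bv.
  have : b \in u |: Q.
    by apply: (clQ a); rewrite ?setU1r // /induced /= au bu Gab.
  by rewrite !in_setU1 (negPf nbu) /= in_setI bv andbT.
rewrite in_setU1 => /predU1P[->|aQ] ab.
  have := induced_acyclic Tr (induced_below ab).
  by case/and3P: ab => _; rewrite inE => /andP[_ ->].
have: a \in below u :\ u by apply: (subsetP sQ).
rewrite -(below_children uT) => /bigcupP[v vu av].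
have abT := induced_below ab.
(* An edge can leave the subtree of [v] only from [v] itself, and then it ends at [u]. *)
move: (av); rewrite inE => /andP[aT] /connect_step-/(_ _ abT)[aE|bv].
  by rewrite in_setU1 (induced_inj Tr (v := b) (w := u) abT) ?eqxx // aE.
have bB : b \in below v by rewrite inE bv andbT; case/and3P: abT.
have abv : induced G (below v) a b.
  by case/and3P: ab => _ _ Gab; rewrite /induced /= av bB Gab.
have /closed_inP/(_ a b) := clQ v vu.
by rewrite !in_setI aQ av => /(_ isT abv)/andP[bQ _]; rewrite setU1r.
Qed.

(** Strong induction on the size of the subtree: a nonempty closed set consists of [u], which gives
    the factor ['X], and of independent closed sets below the children. *)
Lemma sum_closed_below u : u \in T ->
  \sum_(Q : {set V} | (Q \subset below u) && closed_in (below u) Q) 'X^#|Q| =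
  tree_poly G T u.
Proof.
have [n] := ubnP #|below u|; elim: n u => // n IHn u lt_n uT.
rewrite (tree_polyE Tr uT) sum_closed_in.
(* A leaf gives an empty product, so both cases of the recursion become one formula. *)
have -> : (if leaf G T u then 1 + 'X
    else 1 + 'X * \prod_(v | induced G T v u) tree_poly G T v) =
  1 + 'X * \prod_(v in [pred v | induced G T v u]) tree_poly G T v.
  case: ifP => // /eqP/setP lf; rewrite big_pred0 ?mulr1 // => v.
  by have := lf v; rewrite !inE.
congr (_ + _).
have -> : \prod_(v in [pred v | induced G T v u]) tree_poly G T v =
  \prod_(v in [pred v | induced G T v u])
    \sum_(Q : {set V} | (Q \subset below v) && closed_in (below v) Q) 'X^#|Q|.
  apply: eq_bigr => v vu; rewrite IHn //; last by case/and3P: vu.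
  exact: leq_trans (card_below Tr vu) lt_n.
rewrite prod_sum_subsets => [|v w vu wu]; last exact: below_disjoint vu wu.
rewrite below_children // big_distrr /=.
(* Removing [u] is invertible on nonempty closed sets, since they all contain the root [u]. *)
rewrite (reindex_onto (fun Q => u |: Q) (fun Q => Q :\ u)) /=; last first.
  by move=> Q /and3P[sQ clQ Q0]; rewrite setD1K // (closed_below_root sQ).
apply: eq_big => [Q|Q].
  apply/idP/idP.
    case/andP=> /and3P[sQ clQ _] /eqP QE.
    have sQ' : Q \subset below u :\ u by rewrite -QE setSD.
    by rewrite sQ' -closed_below_setU1.
  case/andP=> sQ clQ; have uQ : u \notin Q.
    by apply/negP => /(subsetP sQ); rewrite !inE eqxx.
  rewrite closed_below_setU1 // clQ setU1K // eqxx andbT /= subUset sub1set.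
  rewrite belowxx // (subset_trans sQ (subsetDl _ _)) /=.
  by apply/set0Pn; exists u; rewrite setU11.
case/andP=> /and3P[_ _ _] /eqP QE.
by rewrite cardsU1 -QE !inE eqxx exprS.
Qed.

Lemma sum_closed_tree :
  \sum_(Q : {set V} | (Q \subset T) && closed_in T Q) 'X^#|Q| =
  tree_poly G T r.
Proof. by rewrite -(sum_closed_below (vrt_root Tr)) below_root. Qed.

Lemma closed_tree_root (Q : {set V}) :
  Q \subset T -> closed_in T Q -> Q != set0 -> r \in Q.
Proof. by rewrite -{1 2}below_root; apply: closed_below_root. Qed.

End Tree.

(** * Cycle-rooted trees *)

Lemma sum_closed_cycle_tree (T : {set V}) c H : cycle_rooted_tree G T c H ->
  \sum_(Q : {set V} | (Q \subset T) && closed_in T Q) 'X^#|Q| =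
  cycle_tree_poly G c H.
Proof.
move=> Tc; rewrite sum_closed_in /cycle_tree_poly; congr (_ + _).
rewrite (big_uniq _ (crt_uniq Tc)) /=.
have HT u v : u \in c -> v \in H u -> v \in T.
  by move=> uc vu; rewrite -(crt_cover Tc); apply/bigcupP; exists u.
have cT : {subset c <= T}.
  by move=> u uc; apply: HT (uc) (vrt_root (crt_trees Tc uc)).
(* Subtracting 1 discards the empty set from the count for each hanging tree. *)
have -> : \prod_(u in c) (tree_poly G (H u) u - 1) =
  \prod_(u in c) \sum_(Q : {set V} | (Q \subset H u) &&
    (closed_in (H u) Q && (Q != set0))) 'X^#|Q|.
  apply: eq_bigr => u uc; rewrite -(sum_closed_tree (crt_trees Tc uc)).
  by rewrite sum_closed_in addrC addKr.
rewrite (@prod_sum_subsets _ _ (mem c) H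
  (fun u Q => closed_in (H u) Q && (Q != set0))); last first.
  by move=> u v uc vc; apply: (crt_disjoint Tc).
rewrite (crt_cover Tc); apply: eq_bigl => Q.
case sQ: (Q \subset T) => //=; apply/andP/forall_inP.
  case=> clQ /set0Pn[w wQ] u uc.
  have HclQ v : v \in c -> closed_in (H v) (Q :&: H v).
    move=> vc; apply/closed_inP => a b; rewrite !inE => /andP[aQ av].
    case/and3P => _ bv Gab; rewrite bv andbT.
    by apply: (closed_inP _ _ clQ a) => //; rewrite /induced /= Gab !(HT v).
  rewrite HclQ //=; have : w \in T by apply: (subsetP sQ).
  rewrite -(crt_cover Tc) => /bigcupP[v vc wv].
  (* [Q] meets the tree hanging at [v], hence contains its root [v]; following the cycle from [v]
     then brings every other cycle vertex into [Q]. *)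
  have : v \in Q :&: H v.
    apply: (closed_tree_root (crt_trees Tc vc)) (HclQ v vc) _.
      exact: subsetIr.
    by apply/set0Pn; exists w; rewrite inE wQ.
  rewrite inE => /andP[vQ _]; apply/set0Pn; exists u.
  rewrite inE (vrt_root (crt_trees Tc uc)) andbT.
  have cycT : cycle (induced G T) c.
    apply: (@sub_in_cycle _ [in c] G); last exact: (crt_cycle Tc).
      by move=> a b /cT aT /cT bT Gab; rewrite /induced /= aT bT.
    exact/allP.
  exact: closed_in_connect clQ vQ (connect_cycle cycT vc uc).
move=> clQ.
(* Conversely, the nonempty closed traces contain all the cycle vertices, so the cycle edges impose
   no further condition. *)
have cQ u : u \in c -> u \in Q.
  move=> uc; have /andP[clu Qu] := clQ u uc.
  have := closed_tree_root (crt_trees Tc uc) (subsetIr _ _) clu Qu.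
  by rewrite inE => /andP[].
split.
  apply/closed_inP => a b aQ /(crt_edges Tc)[[ac ->]|[w wc ab]].
    by rewrite cQ // mem_next.
  have /andP[/closed_inP/(_ a b) clw _] := clQ w wc.
  have aw : a \in H w by case/and3P: ab.
  by have := clw _ ab; rewrite !inE aQ aw => /(_ isT)/andP[].
have := crt_nonempty Tc; case cE: c => [//|u c'] _; apply/set0Pn; exists u.
by rewrite cQ // cE mem_head.
Qed.

(** * Disjoint unions and the product formula *)

(** Every edge lies inside one part, so a set is successor-closed exactly when its trace on each
    part is closed there. *)
Lemma counting_poly_disjoint_union (I : finType) (T : I -> {set V}) :
  disjoint_union G T ->
  counting_poly G =
  \prod_i \sum_(Q : {set V} | (Q \subset T i) && closed_in (T i) Q) 'X^#|Q|.
Proof.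
move=> GT; rewrite (@prod_sum_subsets _ _ predT T (fun i => closed_in (T i)));
  last by move=> i j _ _; apply: (du_disjoint GT).
rewrite (du_cover GT) /counting_poly; apply: eq_bigl => Q.
rewrite subsetT /=; apply/forall_inP/forall_inP => [clQ i _|clQ u uQ].
  apply/closed_inP => a b; rewrite !inE => /andP[aQ _] /and3P[_ -> Gab].
  by rewrite andbT; apply: (subsetP (clQ a aQ)); rewrite inE.
apply/subsetP => v; rewrite inE => /(du_edges GT)[i uv].
have /closed_inP/(_ u v) := clQ i isT; have ui : u \in T i by case/and3P: uv.
by rewrite !inE uQ ui => /(_ isT uv)/andP[].
Qed.

End Closed.

Theorem theorem3p1 (V : finType) (G : rel V)
  (G_loopless : irreflexive G) (G_functional : functional G)
  (s_v s_c : nat)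
  (Tv : 'I_s_v -> {set V}) (r : 'I_s_v -> V)
  (Tc : 'I_s_c -> {set V}) (c : 'I_s_c -> seq V) (H : 'I_s_c -> V -> {set V})
  (G_union : disjoint_union G
     (fun i : 'I_s_v + 'I_s_c =>
        match i with inl j => Tv j | inr k => Tc k end))
  (Tv_tree : forall j, vertex_rooted_tree G (Tv j) (r j))
  (Tc_tree : forall k, cycle_rooted_tree G (Tc k) (c k) (H k)) :
  counting_poly G =
    (\prod_(j < s_v) tree_poly G (Tv j) (r j)) *
    (\prod_(k < s_c) cycle_tree_poly G (c k) (H k)).
Proof.
rewrite (counting_poly_disjoint_union G_union) big_sumType /=; congr (_ * _).
  by apply: eq_bigr => j _; apply: sum_closed_tree.
by apply: eq_bigr => k _; apply: sum_closed_cycle_tree.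
Qed.
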